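(* Let $f=\frac1n\sum_{i=1}^n f_i$ where each $f_i:\mathbb{R}^d\to\mathbb{R}$ is $L_i$-smooth (not necessarily convex), $f$ is $L$-smooth, and $f$ satisfies the Polyak-Lojasiewicz condition with constant $\mu>0$: $$\|\nabla f(x)\|^2\ge2\mu(f(x)-f^* )\quad\text{for all }x\in\mathbb{R}^d.$$ Let $x^*$ be a minimizer of $f$ and $L_{\max}=\max_{1\le i\le n}L_i$. Then the iterates of SGD with constant step-size $\gamma_k=\gamma$, $0<\gamma\le\frac{\mu}{L_{\max}^2}$, satisfy, for all $k\ge0$, $$\mathbb{E}[f(x^k)-f(x^* )]\le\nu^k\,[f(x^0)-f(x^* )]+\frac{L\sigma^2\gamma}{2(1-\nu)c},\qquad\text{where } \nu=1-\mu\gamma,\quad c=\frac{L_{\max}}{2\mu}.$$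
   Context: Setting: $f(x)=\frac1n\sum_{i=1}^n f_i(x)$ is minimized over $\mathbb{R}^d$; the set $\mathcal{X}^*$ of minimizers of $f$ is nonempty and $f^*=f(x^* )$ is the minimum value. A function is $L$-smooth if it is differentiable with $L$-Lipschitz gradient. $L$ and $L_i$ denote the smoothness constants of $f$ and $f_i$, with $L\le L_{\max}$. For each $i$, $f_i^*:=\inf_x f_i(x)$, and it is assumed throughout that $\sigma^2:=\mathbb{E}_i[f_i(x^* )-f_i^*]=f(x^* )-\frac1n\sum_{i=1}^n f_i^*<\infty$ (so all $f_i^*$ are finite), where $x^*\in\mathcal{X}^*$. SGD with constant step-size $\gamma$: starting from a deterministic $x^0$, at each iteration $k$ an index $i\in\{1,\dots,n\}$ is drawn uniformly at random, independently of the past, and $x^{k+1}=x^k-\gamma\nabla f_i(x^k)$. *)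

(* Defs.v *)
From HB Require Import structures.
From mathcomp Require Import all_boot all_order all_algebra.
From mathcomp Require Import all_classical all_reals all_analysis.
Set Implicit Arguments.
Unset Strict Implicit.
Unset Printing Implicit Defensive.
Import Order.TTheory GRing.Theory Num.Theory.
Import numFieldNormedType.Exports.
Local Open Scope classical_set_scope.
Local Open Scope ring_scope.

(* The library norm on 'rV[R]_d is the sup norm, hence an explicit Euclidean
   norm. Both induce the same topology, so the library's [differentiable] is the
   usual notion. *)
Definition enorm (R : realType) (d : nat) (x : 'rV[R]_d) : R :=
  Num.sqrt (\sum_(j < d) x 0 j ^+ 2).

Definition gradient (R : realType) (d : nat) (g : 'rV[R]_d -> R)
    (x : 'rV[R]_d) : 'rV[R]_d :=
  \row_(j < d) 'D_(delta_mx 0 j) g x.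

Definition smooth (R : realType) (d : nat) (L : R) (g : 'rV[R]_d -> R) : Prop :=
  (forall x, differentiable g x) /\
  (forall x y, enorm (gradient g x - gradient g y) <= L * enorm (x - y)).

Definition minimizer (R : realType) (d : nat) (g : 'rV[R]_d -> R)
    (z : 'rV[R]_d) : Prop :=
  forall x, g z <= g x.

Definition polyak_lojasiewicz (R : realType) (d : nat) (mu : R)
    (g : 'rV[R]_d -> R) (gstar : R) : Prop :=
  forall x, 2 * mu * (g x - gstar) <= enorm (gradient g x) ^+ 2.

Definition average (R : realType) (d n : nat) (f : 'I_n -> 'rV[R]_d -> R)
    (x : 'rV[R]_d) : R :=
  n%:R^-1 * \sum_(i < n) f i x.

(* Lipschitz constants are nonnegative, so 0 is a harmless default value. *)
Definition Lmax (R : realType) (n : nat) (L : 'I_n -> R) : R :=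
  \big[Num.max/0]_(i < n) L i.

(* Extended-real valued: -oo when g is not bounded below. *)
Definition infimum (R : realType) (d : nat) (g : 'rV[R]_d -> R) : \bar R :=
  ereal_inf (range (fun x => (g x)%:E)).

Definition sigma2 (R : realType) (d n : nat) (f : 'I_n -> 'rV[R]_d -> R)
    (z : 'rV[R]_d) : \bar R :=
  ((n%:R^-1)%:E * \sum_(i < n) ((f i z)%:E - infimum (f i)))%E.

Definition past (T : Type) (n : nat) (I : nat -> T -> 'I_n) (k : nat) (w : T) :
    k.-tuple 'I_n :=
  [tuple I (val j) w | j < k].

(* 'I_n and k.-tuple 'I_n are finite, so arbitrary sets of values are allowed. *)
Definition uniform_sampling (R : realType) (disp : measure_display)
    (T : measurableType disp) (P : probability T R) (n : nat)
    (I : nat -> T -> 'I_n) : Prop :=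
  [/\ forall k (i : 'I_n), measurable (I k @^-1` [set i]),
      forall k (i : 'I_n), P (I k @^-1` [set i]) = (n%:R^-1)%:E
    & forall k (A : set 'I_n) (B : set (k.-tuple 'I_n)),
        P ((I k @^-1` A) `&` (past I k @^-1` B)) =
        (P (I k @^-1` A) * P (past I k @^-1` B))%E].

Fixpoint sgd (R : realType) (T : Type) (d n : nat) (f : 'I_n -> 'rV[R]_d -> R)
    (gamma : R) (x0 : 'rV[R]_d) (I : nat -> T -> 'I_n) (k : nat) (w : T) :
    'rV[R]_d :=
  if k is k'.+1 then
    let x := sgd f gamma x0 I k' w in x - gamma *: gradient (f (I k' w)) x
  else x0.

(* Main.v *)
Require Import Defs.
From HB Require Import structures.
From mathcomp Require Import all_boot all_order all_algebra.
From mathcomp Require Import all_classical all_reals all_analysis.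
From mathcomp Require Import ring lra.
Import Order.TTheory GRing.Theory Num.Theory.
Import numFieldNormedType.Exports.
Local Open Scope classical_set_scope.
Local Open Scope ring_scope.

Set Implicit Arguments.
Unset Strict Implicit.
Unset Printing Implicit Defensive.

(** The quantity [Delta x = f x - f xstar] contracts in mean along SGD.  Write
    [M] for the largest smoothness constant and [g_i] for the gradient of [f_i]
    at the current iterate [x].

    The descent lemma for [f] ([smooth_descent]) bounds
    [f (x - gamma g_i)] by
    [f x - gamma <grad f x, g_i> + L/2 gamma^2 |g_i|^2].  A smooth function
    which is bounded below by [m_i] satisfies [|g_i|^2 <= 2 M (f_i x - m_i)]
    ([sqr_gradient_le]: apply the descent lemma to a step of length [1/M]).
    Averaging over [i] turns the inner product into [|grad f x|^2], which the
    Polyak-Lojasiewicz inequality bounds below by [2 mu Delta x], and turns the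
    last term into [L M gamma^2 (Delta x + sigma2)].  Since
    [L M gamma^2 <= M^2 gamma^2 <= mu gamma], the mean of [Delta] after one step
    is at most [(1 - mu gamma) Delta x + L M gamma^2 sigma2] ([sgd_mean_step]).

    The iterate number [k] is a function of the first [k] indices, which take
    finitely many values, so expectations are finite sums; independence of the
    next index from the past then makes the expectation over one more step the
    expectation of the mean over [i] ([expectation_sgdS]).  Hence
    [e_(k+1) <= nu e_k + L M gamma^2 sigma2] with [e_k] the expected gap, and the
    constant [C = L sigma2 / M], which is the closed form of the error term in
    the claim, satisfies [L M gamma^2 sigma2 <= (1 - nu) C].

    The induction needs [0 <= nu] and [0 <= L].  If [Delta] is not identically
    zero, comparing Polyak-Lojasiewicz with [sqr_gradient_le] gives [mu <= M],
    hence [mu gamma <= 1]; and [L] can only be negative in dimension 0, where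
    [Delta] vanishes.  If [Delta] is identically zero, only [0 <= C] is left to
    prove; in dimension 0 it holds because [sigma2] vanishes. *)

(** * Euclidean inner product *)

(** The Euclidean inner product, whose associated norm is [enorm]. *)
Definition edot (R : realType) (d : nat) (x y : 'rV[R]_d) : R :=
  \sum_(j < d) x 0 j * y 0 j.

Lemma edotC (R : realType) (d : nat) (x y : 'rV[R]_d) : edot x y = edot y x.
Proof. by apply: eq_bigr => j _; rewrite mulrC. Qed.

Lemma edotDr (R : realType) (d : nat) (x y z : 'rV[R]_d) :
  edot x (y + z) = edot x y + edot x z.
Proof. by rewrite -big_split; apply: eq_bigr => j _; rewrite mxE mulrDr. Qed.

Lemma edotZr (R : realType) (d : nat) (a : R) (x y : 'rV[R]_d) :
  edot x (a *: y) = a * edot x y.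
Proof. by rewrite mulr_sumr; apply: eq_bigr => j _; rewrite mxE mulrCA. Qed.

Lemma edotZl (R : realType) (d : nat) (a : R) (x y : 'rV[R]_d) :
  edot (a *: x) y = a * edot x y.
Proof. by rewrite edotC edotZr edotC. Qed.

Lemma edotBl (R : realType) (d : nat) (x y z : 'rV[R]_d) :
  edot (x - y) z = edot x z - edot y z.
Proof. by rewrite edotC edotDr -scaleN1r edotZr mulN1r !(edotC z). Qed.

Lemma edotBr (R : realType) (d : nat) (x y z : 'rV[R]_d) :
  edot x (y - z) = edot x y - edot x z.
Proof. by rewrite edotC edotBl !(edotC x). Qed.

Lemma edot_sumr (R : realType) (d : nat) (J : Type) (s : seq J)
    (F : J -> 'rV[R]_d) (x : 'rV[R]_d) :
  edot x (\sum_(i <- s) F i) = \sum_(i <- s) edot x (F i).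
Proof.
elim/big_rec2: _ => [|i y z _ <-]; last by rewrite edotDr.
by rewrite /edot big1 // => j _; rewrite mxE mulr0.
Qed.

Lemma edotxx_ge0 (R : realType) (d : nat) (x : 'rV[R]_d) : 0 <= edot x x.
Proof. by apply: sumr_ge0 => j _; rewrite -expr2 sqr_ge0. Qed.

Lemma sqr_enorm (R : realType) (d : nat) (x : 'rV[R]_d) :
  enorm x ^+ 2 = edot x x.
Proof.
rewrite /enorm sqr_sqrtr; last by apply: sumr_ge0 => j _; exact: sqr_ge0.
by apply: eq_bigr => j _; rewrite expr2.
Qed.

Lemma enorm_ge0 (R : realType) (d : nat) (x : 'rV[R]_d) : 0 <= enorm x.
Proof. exact: sqrtr_ge0. Qed.

Lemma enormZ_ge0 (R : realType) (d : nat) (t : R) (x : 'rV[R]_d) :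
  0 <= t -> enorm (t *: x) = t * enorm x.
Proof.
move=> t0; apply/eqP; rewrite -(eqrXn2 (n := 2)) ?enorm_ge0 ?mulr_ge0 ?enorm_ge0 //.
by rewrite exprMn !sqr_enorm edotZr edotZl mulrA expr2.
Qed.

Lemma enorm_eq0 (R : realType) (d : nat) (x : 'rV[R]_d) :
  enorm x = 0 -> x = 0.
Proof.
move=> x0; have /eqP : edot x x = 0 by rewrite -sqr_enorm x0 expr0n.
rewrite psumr_eq0 => [/allP xx0|j _]; last by rewrite -expr2 sqr_ge0.
apply/rowP => j; rewrite mxE; apply/eqP.
by move: (xx0 j (mem_index_enum j)); rewrite /= mulf_eq0 orbb.
Qed.

(** The Cauchy-Schwarz inequality. *)
Lemma edot_le_enorm (R : realType) (d : nat) (x y : 'rV[R]_d) :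
  edot x y <= enorm x * enorm y.
Proof.
have e0 z : edot z (0 : 'rV[R]_d) = 0.
  by rewrite -(scale0r (0 : 'rV[R]_d)) edotZr mul0r.
have [/enorm_eq0 ->|nx0] := eqVneq (enorm x) 0.
  by rewrite edotC e0 mulr_ge0 ?enorm_ge0.
have [/enorm_eq0 ->|ny0] := eqVneq (enorm y) 0.
  by rewrite e0 mulr_ge0 ?enorm_ge0.
have x0 : 0 < enorm x by rewrite lt_def nx0 enorm_ge0.
have y0 : 0 < enorm y by rewrite lt_def ny0 enorm_ge0.
(* Expanding this square gives 2 |x| |y| <x, y> <= 2 |x|^2 |y|^2. *)
have := edotxx_ge0 (enorm y *: x - enorm x *: y).
rewrite edotBl !edotBr !edotZr !edotZl -!sqr_enorm (edotC y x) => h.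
rewrite -(ler_pM2l (mulr_gt0 x0 y0)); nra.
Qed.

(** * Smooth functions *)

Lemma derive_edot (R : realType) (d : nat) (g : 'rV[R]_d -> R)
    (x h : 'rV[R]_d) :
  differentiable g x -> 'D_h g x = edot (gradient g x) h.
Proof.
move=> dg; rewrite deriveE // {1}[h]row_sum_delta linear_sum.
apply: eq_bigr => j _; rewrite linearZ /= mxE deriveE //.
by rewrite mulrC.
Qed.

Lemma is_derive_line (R : realType) (d : nat) (g : 'rV[R]_d -> R)
    (x h : 'rV[R]_d) (t : R) :
  differentiable g (x + t *: h) ->
  is_derive t 1 (fun s : R => g (x + s *: h)) (edot (gradient g (x + t *: h)) h).
Proof.
move=> dg.
have E : (fun e : R => e^-1 *: (((fun s : R => g (x + s *: h)) \o shift t) (e *: (1 : R))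
             - g (x + t *: h)))
  = (fun e : R => e^-1 *: ((g \o shift (x + t *: h)) (e *: h) - g (x + t *: h))).
  apply/funext => e /=; congr (_ *: (g _ - _)).
  by rewrite /shift /= [e *: 1]mulr1 scalerDl addrCA.
apply: DeriveDef; first by rewrite /derivable E; exact: diff_derivable.
by rewrite -derive_edot // /derive E.
Qed.

(** The descent lemma.  No sign is imposed on [L]. *)
Lemma smooth_descent (R : realType) (d : nat) (L : R) (g : 'rV[R]_d -> R)
    (x h : 'rV[R]_d) :
  smooth L g ->
  g (x + h) <= g x + edot (gradient g x) h + L / 2 * enorm h ^+ 2.
Proof.
move=> [dg lg].
(* The quadratic upper bound at x + h says psi 1 <= psi 0; Cauchy-Schwarz and
   the Lipschitz gradient make the derivative of psi nonpositive on [0, 1]. *)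
pose psi (t : R) :=
  g (x + t *: h) - (t * edot (gradient g x) h + t ^+ 2 * (L / 2 * enorm h ^+ 2)).
have dpsi (t : R) : is_derive t 1 psi
    (edot (gradient g (x + t *: h)) h
     - (edot (gradient g x) h + t * (L * enorm h ^+ 2))).
  have := is_derive_line (dg (x + t *: h)) => H.
  apply: is_derive_eq.
  by congr (_ - _); rewrite /GRing.scale /=; field.
have : psi 1 <= psi 0.
  apply: (@ler0_derive1_nincr R psi 0 1) => //.
  - move=> t; rewrite in_itv /= => /andP[t0 t1].
    rewrite derive1E derive_val.
    have := edot_le_enorm (gradient g (x + t *: h) - gradient g x) h.
    rewrite edotBl => /le_trans cs.
    suff : edot (gradient g (x + t *: h)) h - edot (gradient g x) h
        <= t * (L * enorm h ^+ 2) by lra.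
    apply: cs.
    have := lg (x + t *: h) x.
    rewrite addrAC subrr add0r enormZ_ge0 ?(ltW t0) // => l1.
    apply: le_trans (ler_wpM2r (enorm_ge0 _) l1) _.
    by rewrite le_eqVlt; apply/orP; left; apply/eqP; ring.
  - apply: derivable_within_continuous => t _.
    by have [] := dpsi t.
rewrite /psi !scale1r !scale0r addr0; lra.
Qed.

Lemma smoothW (R : realType) (d : nat) (L M : R) (g : 'rV[R]_d -> R) :
  L <= M -> smooth L g -> smooth M g.
Proof.
move=> LM [dg lg]; split=> // x y; apply: le_trans (lg x y) _.
by rewrite ler_wpM2r ?enorm_ge0.
Qed.

(** The squared gradient is controlled by the distance to any lower bound [m]:
    a gradient step of length [1/L] decreases [g] by [|grad g x|^2 / (2 L)], and
    cannot go below [m]. *)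
Lemma sqr_gradient_le (R : realType) (d : nat) (L m : R) (g : 'rV[R]_d -> R)
    (x : 'rV[R]_d) :
  0 < L -> smooth L g -> (forall y, m <= g y) ->
  enorm (gradient g x) ^+ 2 <= 2 * L * (g x - m).
Proof.
move=> L0 sg mg.
have := smooth_descent x (- L^-1 *: gradient g x) sg.
rewrite sqr_enorm !edotZr edotZl -!sqr_enorm.
move=> /(le_trans (mg _)); set s := enorm _ ^+ 2.
have -> : L / 2 * (- L^-1 * (- L^-1 * s)) = s / L / 2.
  by field; rewrite gt_eqF.
move=> h; suff : s / L <= 2 * (g x - m) by rewrite ler_pdivrMr //; lra.
lra.
Qed.

Lemma gradient_average (R : realType) (d n : nat) (f : 'I_n -> 'rV[R]_d -> R)
    (x : 'rV[R]_d) :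
  (forall i, differentiable (f i) x) ->
  gradient (average f) x = n%:R^-1 *: \sum_(i < n) gradient (f i) x.
Proof.
move=> df; apply/rowP => j; rewrite !mxE summxE.
have -> : average f = n%:R^-1 *: (\sum_(i < n) f i).
  by apply/funext => y; rewrite /average fctE /= fct_sumE.
rewrite deriveZ ?derive_sum //=.
- by congr (_ * _); apply: eq_bigr => i _; rewrite mxE.
- by move=> i; exact: diff_derivable.
- by apply: derivable_sum => i; exact: diff_derivable.
Qed.

(** The index [j] witnesses that the dimension is positive; in dimension 0 every
    [L] is a smoothness constant. *)
Lemma smooth_ge0 (R : realType) (d : nat) (L : R) (g : 'rV[R]_d -> R)
    (j : 'I_d) :
  smooth L g -> 0 <= L.
Proof.
move=> [_ lg]; have := lg (delta_mx 0 j) 0; rewrite subr0.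
set e := delta_mx 0 j => /(le_trans (enorm_ge0 _)).
suff e0 : 0 < enorm e by rewrite pmulr_lge0.
rewrite lt_def enorm_ge0 andbT; apply/eqP => /enorm_eq0 /rowP /(_ j).
by rewrite !mxE !eqxx /=; apply/eqP; exact: oner_neq0.
Qed.

(** * The mean effect of one SGD step *)

(** Finiteness of [sigma2] forces every infimum to be a real number [m i],
    characterized here as a greatest lower bound, and makes [sigma2] a real
    average. *)
Lemma sigma2_finite (R : realType) (d n : nat) (f : 'I_n -> 'rV[R]_d -> R)
    (z : 'rV[R]_d) :
  (0 < n)%N -> (sigma2 f z < +oo)%E ->
  exists m : 'I_n -> R,
    [/\ forall i y, m i <= f i y,
        forall i b, (forall y, b <= f i y) -> b <= m i
      & fine (sigma2 f z) = n%:R^-1 * \sum_(i < n) (f i z - m i)].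
Proof.
move=> n0 sz.
have inf_le i y : (Defs.infimum (f i) <= (f i y)%:E)%E.
  by apply: ereal_inf_lbound; exists y.
have inf_fin i : Defs.infimum (f i) \is a fin_num.
  apply/fin_numP; split; last first.
    by apply/eqP => E; have := inf_le i z; rewrite E leye_eq.
  apply/eqP => E; move: sz; rewrite /sigma2.
  (* One infinite term makes the whole sum infinite, as no term is -oo. *)
  have -> : (\sum_(i < n) ((f i z)%:E - Defs.infimum (f i)) = +oo)%E.
    apply/esum_eqyP => [j _|].
      by move: (inf_le j z); case: (Defs.infimum (f j)).
    by exists i; rewrite mem_index_enum E.
  by rewrite gt0_muley ?ltxx // lte_fin invr_gt0 ltr0n.
exists (fun i => fine (Defs.infimum (f i))); split=> [i y|i b bf|].
- by rewrite -lee_fin fineK.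
- by rewrite -lee_fin fineK //; apply/ereal_infP => _ [y _ <-]; rewrite lee_fin.
- rewrite /sigma2 (eq_bigr (fun i => (f i z - fine (Defs.infimum (f i)))%:E)).
    by rewrite sumEFin -EFinM.
  by move=> i _; rewrite EFinB fineK.
Qed.

(** One SGD step from [x], averaged over the index [i], contracts the gap
    [average f x - average f z] by [1 - mu * gamma] up to a noise term. *)
Lemma sgd_mean_step (R : realType) (d n : nat) (f : 'I_n -> 'rV[R]_d -> R)
    (L M mu gamma : R) (m : 'I_n -> R) (z x : 'rV[R]_d) :
  (0 < n)%N -> 0 < M -> 0 <= L <= M ->
  (forall i, smooth M (f i)) -> smooth L (average f) ->
  (forall i y, m i <= f i y) ->
  minimizer (average f) z ->
  polyak_lojasiewicz mu (average f) (average f z) ->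
  0 < gamma -> gamma * M ^+ 2 <= mu ->
  n%:R^-1 * \sum_(i < n)
      (average f (x - gamma *: gradient (f i) x) - average f z) <=
  (1 - mu * gamma) * (average f x - average f z) +
    L * M * gamma ^+ 2 * (n%:R^-1 * \sum_(i < n) (f i z - m i)).
Proof.
move=> n0 M0 /andP[L0 LM] fM FL mf zmin pl g0 gM.
have nR : n%:R != 0 :> R by rewrite pnatr_eq0 -lt0n.
set F := average f; set G := gradient F x.
have meanc (c : R) : n%:R^-1 * \sum_(i < n) c = c.
  by rewrite sumr_const card_ord -(mulr_natl c) mulKf.
have step i : F (x - gamma *: gradient (f i) x) - F z <=
    (F x - F z) - gamma * edot G (gradient (f i) x)
      + L * M * gamma ^+ 2 * (f i x - m i).
  have := smooth_descent x (- gamma *: gradient (f i) x) FL.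
  rewrite edotZr sqr_enorm edotZr edotZl -sqr_enorm.
  have := sqr_gradient_le x M0 (fM i) (mf i).
  set s := enorm _ ^+ 2 => sle.
  have : L * gamma ^+ 2 * s <= L * gamma ^+ 2 * (2 * M * (f i x - m i)).
    by rewrite ler_wpM2l // mulr_ge0 // sqr_ge0.
  rewrite scaleNr -/F -/G; lra.
have meanG : n%:R^-1 * \sum_(i < n) edot G (gradient (f i) x) = enorm G ^+ 2.
  rewrite -edot_sumr -edotZr -gradient_average ?sqr_enorm // => i.
  by have [] := fM i.
have meanm : n%:R^-1 * \sum_(i < n) (f i x - m i)
    = (F x - F z) + n%:R^-1 * \sum_(i < n) (f i z - m i).
  by rewrite /F /average !sumrB; ring.
have s0 : 0 <= n%:R^-1 * \sum_(i < n) (f i z - m i).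
  by rewrite mulr_ge0 ?invr_ge0 ?ler0n ?sumr_ge0 // => i _; rewrite subr_ge0.
apply: (@le_trans _ _ ((F x - F z) - gamma * enorm G ^+ 2
    + L * M * gamma ^+ 2 * ((F x - F z) + n%:R^-1 * \sum_(i < n) (f i z - m i)))).
  rewrite -meanG -meanm -[X in X - _ + _](meanc (F x - F z)).
  have -> : forall A B C a b : R, n%:R^-1 * A - a * (n%:R^-1 * B) +
      b * (n%:R^-1 * C) = n%:R^-1 * (A - a * B + b * C) by move=> *; ring.
  rewrite ler_pM2l ?invr_gt0 ?ltr0n // !mulr_sumr -sumrB -big_split /=.
  by apply: ler_sum => i _; exact: step.
set D := F x - F z; set s2 := n%:R^-1 * _ in s0 *.
have D0 : 0 <= D by rewrite subr_ge0.
have plx : gamma * (2 * mu * D) <= gamma * enorm G ^+ 2.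
  by rewrite ler_pM2l //; exact: pl.
have LMg : L * M * gamma ^+ 2 * D <= mu * gamma * D.
  rewrite ler_wpM2r //.
  have : L * (M * gamma ^+ 2) <= M * (M * gamma ^+ 2).
    by rewrite ler_wpM2r // mulr_ge0 ?sqr_ge0 // ltW.
  have : gamma * (gamma * M ^+ 2) <= gamma * mu by rewrite ler_pM2l.
  lra.
lra.
Qed.

(** * Expectations along the iterates *)

Lemma expectation_finite (R : realType) (disp : measure_display)
    (T : measurableType disp) (P : probability T R) (K : finType) (Z : T -> K)
    (G : K -> R) :
  (forall z, measurable (Z @^-1` [set z])) ->
  'E_P[fun w => G (Z w)]%E =
    (\sum_(z : K) fine (P (Z @^-1` [set z])) * G z)%:E.
Proof.
move=> mZ; rewrite unlock.
have -> : (fun w => (G (Z w))%:E) =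
    (fun w => \sum_(z : K) (G z)%:E * (\1_(Z @^-1` [set z]) w)%:E)%E.
  apply/funext => w; rewrite (bigD1 (Z w)) //= big1 => [|z zw].
    by rewrite adde0 indicE mem_set // mule1.
  rewrite indicE memNset ?mule0 //= => E.
  by rewrite E eqxx in zw.
have iZ z : P.-integrable setT (fun w => (\1_(Z @^-1` [set z]) w)%:E).
  exact: integrable_indic.
rewrite integral_sum //; last by move=> z; exact: integrableZl.
rewrite -sumEFin; apply: eq_bigr => z _.
rewrite integralZl // integral_indic // setIT muleC EFinM fineK //.
exact: fin_num_measure.
Qed.

Lemma expectation_finite_le_affine (R : realType) (disp : measure_display)
    (T : measurableType disp) (P : probability T R) (K : finType) (Z : T -> K)
    (G H : K -> R) (a b : R) :
  (forall z, measurable (Z @^-1` [set z])) ->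
  (forall z, G z <= a * H z + b) ->
  fine 'E_P[fun w => G (Z w)]%E <= a * fine 'E_P[fun w => H (Z w)]%E + b.
Proof.
move=> mZ GH; rewrite !expectation_finite //=.
have p1 : \sum_(z : K) fine (P (Z @^-1` [set z])) = 1.
  have := expectation_cst P (1 : R).
  rewrite (expectation_finite (Z := Z) P (fun=> 1)) // => -[<-].
  by apply: eq_bigr => z _; rewrite mulr1.
rewrite -[b in leRHS]mul1r -p1 mulr_suml mulr_sumr -big_split /=.
apply: ler_sum => z _; rewrite mulrCA -mulrDr ler_wpM2l //.
exact: fine_ge0.
Qed.

Lemma measurable_past (disp : measure_display) (T : measurableType disp)
    (n : nat) (I : nat -> T -> 'I_n) (k : nat) (t : k.-tuple 'I_n) :
  (forall j (i : 'I_n), measurable (I j @^-1` [set i])) ->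
  measurable (past I k @^-1` [set t]).
Proof.
move=> mI.
have -> : past I k @^-1` [set t] =
    \bigcap_(j in [set: 'I_k]) (I j @^-1` [set tnth t j]).
  apply/seteqP; split => w /=.
    by move=> <- j _; rewrite /= tnth_mktuple.
  by move=> E; apply: eq_from_tnth => j; rewrite tnth_mktuple; exact: E.
by apply: fin_bigcap_measurable => // j _; exact: mI.
Qed.

Lemma eq_sgd (R : realType) (T T' : Type) (d n : nat)
    (f : 'I_n -> 'rV[R]_d -> R) (gamma : R) (x0 : 'rV[R]_d)
    (I : nat -> T -> 'I_n) (I' : nat -> T' -> 'I_n) (k : nat) (w : T) (w' : T') :
  (forall j, (j < k)%N -> I j w = I' j w') ->
  sgd f gamma x0 I k w = sgd f gamma x0 I' k w'.
Proof.
elim: k => //= k IH E; rewrite E // IH // => j jk.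
by apply: E; exact: ltnW.
Qed.

(** The iterate [k] is determined by the first [k] indices. *)
Lemma sgd_past (R : realType) (T : Type) (d n : nat)
    (f : 'I_n -> 'rV[R]_d -> R) (gamma : R) (x0 : 'rV[R]_d)
    (I : nat -> T -> 'I_n) (k : nat) :
  (0 < n)%N ->
  exists X : k.-tuple 'I_n -> 'rV[R]_d,
    forall w, sgd f gamma x0 I k w = X (past I k w).
Proof.
move=> n0; pose i0 := Ordinal n0.
(* Replay the recursion on the recorded indices, over a one-point space; the
   default i0 is never read. *)
exists (fun t => sgd f gamma x0 (fun j (_ : unit) => nth i0 t j) k tt) => w.
apply: eq_sgd => j jk.
by rewrite -(tnth_nth i0 _ (Ordinal jk)) tnth_mktuple.
Qed.

(** The last index is uniform and independent of the past, so it can be averaged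
    out: this is the tower property, with the conditional expectation given the
    past written as the mean over [i]. *)
Lemma expectation_sgdS (R : realType) (disp : measure_display)
    (T : measurableType disp) (P : probability T R) (d n : nat)
    (f : 'I_n -> 'rV[R]_d -> R) (gamma : R) (x0 : 'rV[R]_d)
    (I : nat -> T -> 'I_n) (h : 'rV[R]_d -> R) (k : nat) :
  (0 < n)%N -> uniform_sampling P I ->
  ('E_P[fun w => h (sgd f gamma x0 I k.+1 w)] =
   'E_P[fun w => (n%:R^-1 * \sum_(i < n)
      h (sgd f gamma x0 I k w - gamma *: gradient (f i) (sgd f gamma x0 I k w)))%R])%E.
Proof.
move=> n0 [mI unifI indI].
have [X XE] := sgd_past f gamma x0 I k n0.
pose Z w := (I k w, past I k w).
have ZE i t : Z @^-1` [set (i, t)] = I k @^-1` [set i] `&` past I k @^-1` [set t].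
  by apply/seteqP; split => w /=; [case=> -> -> | case=> <- <-].
have mpast t : measurable (past I k @^-1` [set t]) by exact: measurable_past.
have mZ z : measurable (Z @^-1` [set z]).
  by case: z => i t; rewrite ZE; apply: measurableI.
pose H (x : 'rV[R]_d) (i : 'I_n) := h (x - gamma *: gradient (f i) x).
transitivity 'E_P[fun w => H (X (Z w).2) (Z w).1]%E.
  by congr expectation; apply/funext => w /=; rewrite XE.
rewrite (expectation_finite P (fun z => H (X z.2) z.1)) //.
transitivity 'E_P[fun w => (n%:R^-1 * \sum_(i < n) H (X (past I k w)) i)%R]%E; last first.
  by congr expectation; apply/funext => w /=; rewrite XE.
rewrite (expectation_finite P (fun t => n%:R^-1 * \sum_(i < n) H (X t) i)) //.
congr EFin.
transitivity (\sum_(i : 'I_n) \sum_(t : k.-tuple 'I_n)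
    fine (P (Z @^-1` [set (i, t)])) * H (X t) i).
  by rewrite pair_bigA; apply: eq_bigr => -[].
rewrite exchange_big; apply: eq_bigr => t _ /=.
rewrite !mulr_sumr; apply: eq_bigr => i _.
rewrite ZE indI unifI fineM ?fin_num_measure //=; ring.
Qed.

(** * The convergence bound *)

Theorem corollary3p7 (R : realType) (d n : nat) (hn : (0 < n)%N)
    (f : 'I_n -> 'rV[R]_d -> R) (Li : 'I_n -> R) (L mu gamma : R)
    (xstar x0 : 'rV[R]_d)
    (disp : measure_display) (T : measurableType disp) (P : probability T R)
    (I : nat -> T -> 'I_n)
    (hfi : forall i, smooth (Li i) (f i))
    (hf : smooth L (average f))
    (hL : L <= Lmax Li)
    (hstar : minimizer (average f) xstar)
    (hsigma : (sigma2 f xstar < +oo)%E)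
    (hmu : 0 < mu)
    (hPL : polyak_lojasiewicz mu (average f) (average f xstar))
    (hgamma0 : 0 < gamma)
    (hgamma : gamma <= mu / Lmax Li ^+ 2)
    (hI : uniform_sampling P I) :
  let nu := 1 - mu * gamma in
  let c := Lmax Li / (2 * mu) in
  forall k : nat,
    ('E_P[fun w => (average f (sgd f gamma x0 I k w) - average f xstar)%R] <=
     (nu ^+ k * (average f x0 - average f xstar)
      + L * fine (sigma2 f xstar) * gamma / (2 * (1 - nu) * c))%:E)%E.
Proof.
move=> nu c k.
have [m [mf mglb s2E]] := sigma2_finite hn hsigma.
set M := Lmax Li in hL hgamma c *.
set s2 := fine _ in s2E *.
have M_ge0 : 0 <= M by rewrite /M /Lmax; exact: bigmax_ge_id.
(* If M = 0 then mu / M ^+ 2 = 0, which contradicts 0 < gamma. *)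
have M0 : 0 < M.
  rewrite lt_def M_ge0 andbT; apply/eqP => M0.
  by move: hgamma; rewrite M0 expr0n invr0 mulr0 leNgt hgamma0.
have gM : gamma * M ^+ 2 <= mu by rewrite -ler_pdivlMr // exprn_gt0.
have fM i : smooth M (f i).
  by apply: smoothW (hfi i); rewrite /M /Lmax; exact: le_bigmax.
pose Delta (x : 'rV[R]_d) := average f x - average f xstar.
have Delta0 x : 0 <= Delta x by rewrite subr_ge0.
have -> : L * s2 * gamma / (2 * (1 - nu) * c) = L * s2 / M.
  by rewrite /nu /c subKr; field; rewrite !gt_eqF.
set C := L * s2 / M.
have s20 : 0 <= s2.
  by rewrite s2E mulr_ge0 ?invr_ge0 ?ler0n ?sumr_ge0 // => i _; rewrite subr_ge0.
have C0 : 0 <= C.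
  rewrite /C divr_ge0 //.
  case: (posnP d) => [d0|d0]; last first.
    by rewrite mulr_ge0 // (smooth_ge0 (Ordinal d0) hf).
  suff -> : s2 = 0 by rewrite mulr0.
  rewrite s2E big1 ?mulr0 // => i _; apply/eqP; rewrite eq_le.
  rewrite subr_ge0 mf andbT subr_le0; apply: mglb => y.
  suff -> : y = xstar by [].
  by apply/rowP => -[j jd]; exfalso; move: jd; rewrite d0 ltn0.
rewrite -/(Delta x0) -[leLHS]/('E_P[fun w => Delta (sgd f gamma x0 I k w)]%E).
(* When Delta vanishes identically, nu may be negative and no induction is
   needed. *)
have [Dz|] := pselect (forall x, Delta x = 0).
  have -> : (fun w => Delta (sgd f gamma x0 I k w)) = cst (0 : R).
    by apply/funext => w; rewrite Dz.
  by rewrite (expectation_cst P (0 : R)) lee_fin Dz mulr0 add0r.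
move=> /existsNP[x /eqP Dx].
have Dx0 : 0 < Delta x by rewrite lt_def Dx Delta0.
have muM : mu <= M.
  have := le_trans (hPL x) (sqr_gradient_le x M0 (smoothW hL hf) hstar).
  by rewrite ler_pM2r // ler_pM2l.
have L0 : 0 <= L.
  rewrite leNgt; apply/negP => L0.
  have d0 : d = 0%N.
    case: (posnP d) => // d0; have := smooth_ge0 (Ordinal d0) hf.
    by rewrite leNgt L0.
  move: Dx0; suff -> : x = xstar by rewrite /Delta subrr ltxx.
  by apply/rowP => -[j jd]; exfalso; move: jd; rewrite d0 ltn0.
have nu0 : 0 <= nu.
  rewrite subr_ge0 -(ler_pM2r (exprn_gt0 2 M0)) mul1r -mulrA.
  by apply: le_trans (ler_wpM2l (ltW hmu) gM) _; rewrite expr2 ler_pM // ltW.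
have mI : forall j (i : 'I_n), measurable (I j @^-1` [set i]) by case: hI.
(* e j is the expected gap at iterate j; EE says that the expectation is
   finite. *)
pose e j := fine 'E_P[fun w => Delta (sgd f gamma x0 I j w)]%E.
have EE j : 'E_P[fun w => Delta (sgd f gamma x0 I j w)]%E = (e j)%:E.
  have [X XE] := sgd_past f gamma x0 I j hn.
  rewrite /e; under eq_fun do rewrite XE.
  rewrite (expectation_finite P (Delta \o X)) // => t.
  exact: measurable_past.
have eS j : e j.+1 <= nu * e j + L * M * gamma ^+ 2 * s2.
  rewrite /e (expectation_sgdS _ _ _ Delta) //.
  have [X XE] := sgd_past f gamma x0 I j hn.
  under [in leLHS]eq_fun do rewrite XE.
  under [in leRHS]eq_fun do rewrite XE.
  apply: (expectation_finite_le_affine P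
    (G := fun t => n%:R^-1 * \sum_(i < n)
       Delta (X t - gamma *: gradient (f i) (X t))) (H := Delta \o X)) => t.
    exact: measurable_past.
  rewrite s2E; apply: sgd_mean_step => //.
  by rewrite L0.
have step_le_C : L * M * gamma ^+ 2 * s2 <= mu * gamma * C.
  have -> : mu * gamma * C = (L * s2 / M * gamma) * mu by rewrite /C; ring.
  have -> : L * M * gamma ^+ 2 * s2 = (L * s2 / M * gamma) * (gamma * M ^+ 2).
    by field; rewrite gt_eqF.
  by rewrite ler_wpM2l // mulr_ge0 // ltW.
rewrite EE lee_fin; elim: k => [|k IH].
  rewrite expr0 mul1r /e (expectation_cst P (Delta x0)) /=; lra.
apply: le_trans (eS k) _.
have := ler_wpM2l nu0 IH; rewrite mulrDr mulrA -exprS => IH'.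
have -> : C = nu * C + mu * gamma * C by rewrite /nu; ring.
lra.
Qed.
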